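(* Let $G(V,E)$ be an $n$-vertex graph, let $k\ge 1$ be an integer, and assume $\mathrm{MM}(G)=\omega(k\log n)$, where $\mathrm{MM}(G)$ denotes the maximum matching size of $G$. Let $\mathsf{ALG}$ be any algorithm that, given a graph $H$, outputs an arbitrary maximum matching of $H$ (viewed as a subgraph of $H$). Then $\mathsf{ALG}$ is an $O(1)$-approximation randomized composable coreset of size $O(n)$ for the maximum matching problem; that is, if $G^{(1)},\dots,G^{(k)}$ is a random $k$-partitioning of $G$, then with high probability over the partitioning, the graph $\mathsf{ALG}(G^{(1)})\cup\dots\cup\mathsf{ALG}(G^{(k)})$ contains a matching of size at least $\mathrm{MM}(G)/C$ for an absolute constant $C$.
   Context: A random $k$-partitioning of the edge set $E$ of a graph $G(V,E)$ is obtained by assigning each edge of $E$ independently to one of $k$ sets $E^{(1)},\dots,E^{(k)}$ chosen uniformly at random; $G^{(i)}:=G(V,E^{(i)})$. For a graph problem $P$, an algorithm $\mathsf{ALG}$ that outputs a subgraph $\mathsf{ALG}(H)\subseteq H$ with at most $s$ edges is an $\alpha$-approximation randomized composable coreset of size $s$ for $P$ if, for a random $k$-partitioning $G^{(1)},\dots,G^{(k)}$ of $G$, $P(\mathsf{ALG}(G^{(1)})\cup\dots\cup\mathsf{ALG}(G^{(k)}))$ is an $\alpha$-approximation of $P(G)$ with high probability over the partitioning. Throughout, the paper assumes $\mathrm{MM}(G)=\omega(k\log n)$. *)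

(* Defs.v *)
From HB Require Import structures.
From mathcomp Require Import all_boot all_order all_algebra.
From mathcomp Require Import boolp classical_sets functions reals topology.
From mathcomp Require Import normedtype landau sequences exp.

Set Implicit Arguments.
Unset Strict Implicit.
Unset Printing Implicit Defensive.

Import Order.TTheory GRing.Theory Num.Theory.
Import numFieldNormedType.Exports.

Local Open Scope ring_scope.

Definition simple_edges (V : finType) (E : {set {set V}}) : bool :=
  [forall e in E, #|e| == 2%N].

Record sgraph (V : finType) := SGraph {
  edges : {set {set V}};
  edges_simple : simple_edges edges
}.

Definition is_matching (V : finType) (G : sgraph V) (M : {set {set V}}) : bool :=
  (M \subset edges G) && finset.trivIset M.

Definition MM (V : finType) (G : sgraph V) : nat :=
  \max_(M : {set {set V}} | is_matching G M) #|M|.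

(* A [k]-partitioning is given by the index of the class of each edge. *)
Definition partitioning (V : finType) (G : sgraph V) (k : nat) :=
  {ffun {e : {set V} | e \in edges G} -> 'I_k}.

Definition part_edges (V : finType) (G : sgraph V) (k : nat)
    (c : partitioning G k) (i : 'I_k) : {set {set V}} :=
  [set val e | e : {e : {set V} | e \in edges G} & c e == i].

Lemma part_simple (V : finType) (G : sgraph V) (k : nat)
  (c : partitioning G k) (i : 'I_k) : simple_edges (part_edges c i).
Proof.
apply/forall_inP => _ /imsetP[e _ ->].
exact: (forall_inP (edges_simple G)) (valP e).
Qed.

Definition part_graph (V : finType) (G : sgraph V) (k : nat)
  (c : partitioning G k) (i : 'I_k) : sgraph V := SGraph (part_simple c i).

Lemma bigcup_simple (V : finType) (k : nat) (H : 'I_k -> sgraph V) :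
  simple_edges (\bigcup_(i < k) edges (H i))%SET.
Proof.
apply/forall_inP => e /finset.bigcupP[i _].
exact: (forall_inP (edges_simple (H i))).
Qed.

Definition union_graph (V : finType) (k : nat) (H : 'I_k -> sgraph V) :
  sgraph V := SGraph (bigcup_simple H).

(* Law of the random [k]-partitioning: the product, over the edges, of the
   uniform distributions on ['I_k]. *)
Definition prob_partitioning (R : realType) (V : finType) (G : sgraph V)
    (k : nat) (A : pred (partitioning G k)) : R :=
  \sum_(c : partitioning G k | A c)
    \prod_(e : {e : {set V} | e \in edges G}) k%:R^-1.

Definition algorithm := forall V : finType, sgraph V -> sgraph V.

Definition outputs_maximum_matching (ALG : algorithm) : Prop :=
  forall (V : finType) (H : sgraph V),
    is_matching H (edges (ALG V H)) /\
    forall M, is_matching H M -> (#|M| <= #|edges (ALG V H)|)%N.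

Record instance := Instance {
  vertex : finType;
  graph : sgraph vertex;
  parts : nat
}.

Definition nvert (x : instance) : nat := #|vertex x|.

Local Open Scope classical_set_scope.

(* Asymptotic statements are about sequences of instances; an event holds with
   high probability when, for every fixed [a], its probability is eventually at
   least [1 - n ^ (- a)], with [n] the number of vertices. *)
Definition whp (R : realType) (I : nat -> instance)
    (A : forall x : instance, pred (partitioning (graph x) (parts x))) : Prop :=
  forall a : nat, \forall j \near \oo,
    1 - (nvert (I j))%:R ^- a <= prob_partitioning R (A (I j)).

(* [P] is the optimal value of a maximization problem, so that an
   [alpha]-approximation of [P G] is a value at least [P G / alpha]. *)
Definition randomized_composable_coreset (R : realType)
    (P : forall V : finType, sgraph V -> nat) (ALG : algorithm)
    (alpha : R) (s : nat -> nat) (I : nat -> instance) : Prop :=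
  (forall (V : finType) (H : sgraph V),
     (edges (ALG V H) \subset edges H) /\ (#|edges (ALG V H)| <= s #|V|)%N) /\
  whp R I (fun x c =>
    (P _ (graph x))%:R / alpha <=
    (P _ (union_graph (fun i => ALG _ (part_graph c i))))%:R).

(* Main.v *)
(* Let mu = MM(G), fix a maximum matching M* of G, and reveal the k parts one by
   one.  Let A be a maximum matching of the union of the coresets revealed before
   part i, and suppose that A is small.  Let O be a maximum matching of the edges
   of part i that touch V(A).  Each edge of O uses a vertex of V(A), so V(A) and
   V(O) meet at most 6|A| edges of M*; the other edges of M* not yet revealed are the
   fresh edges.  O together with the fresh edges falling in part i is a matching
   of part i, so a maximum matching of part i has at least as many edges avoiding
   V(A) as there are fresh edges in part i, and A can be extended by them.  The
   set of fresh edges does not change when they are redistributed among the parts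
   from i on, so each of them falls in part i with probability at least 1/k
   independently of the others.  As long as i <= k/2, a constant fraction of M* is
   unrevealed, and a Chernoff bound yields a gain of order mu/k at each of the
   first k/2 steps. *)

Require Import Defs.
From HB Require Import structures.
From mathcomp Require Import all_boot all_order all_algebra.
From mathcomp Require Import reals sequences exp.
From mathcomp Require Import zify lra.

Set Implicit Arguments.
Unset Strict Implicit.
Unset Printing Implicit Defensive.

Import Order.TTheory GRing.Theory Num.Theory.

Local Open Scope ring_scope.

(** * Lower tail bound for a random set that is stable under its own recolouring *)

Section ResampleTail.

Variables (R : realType) (E K : finType).
Variables (S : {ffun E -> K} -> {set E}) (D T : {set K}).

Hypothesis sTD : T \subset D.
Hypothesis T_neq0 : T != set0.
Hypothesis S_D : forall c e, e \in S c -> c e \in D.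
(** Together with [S_D], this says that, given [S c] and the colours outside it, the colours on
    [S c] are independent and uniform on [D]. Each of them then lies in [T] with probability [q]. *)
Hypothesis S_resample : forall c c' : {ffun E -> K},
  (forall e, e \notin S c -> c' e = c e) ->
  (forall e, e \in S c -> c' e \in D) -> S c' = S c.

Let q : R := #|T|%:R / #|D|%:R.
Let hits (c : {ffun E -> K}) : {set E} := [set e in S c | c e \in T].

(** The class of [d] is encoded as [family (resampling d)], a product of colour sets, so that
    exponential moments over it factor. *)
Let resampling (d : {ffun E -> K}) (e : E) : {set K} :=
  if e \in S d then D else [set d e].

Let weight (d : {ffun E -> K}) (e : E) (j : K) : R :=
  if (e \in S d) && (j \in T) then expR (-1) else 1.

Let D_gt0 : 0 < #|D|%:R :> R.
Proof.
rewrite ltr0n (leq_trans _ (subset_leq_card sTD)) //.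
by rewrite card_gt0.
Qed.

Let S_family c d : c \in family (resampling d) -> S c = S d.
Proof.
move/familyP=> cd; apply: S_resample => e eS.
  by move: (cd e); rewrite /resampling (negPf eS) inE => /eqP.
by move: (cd e); rewrite /resampling eS.
Qed.

(** For [e] in [S d], the average weight over [D] is [1 - q (1 - 1/e)] with [e] Euler's number. As
    [1/e <= 1/2], this is at most [1 - q / 2 <= expR (- (q / 2))]. *)
Let sum_weight_le d e :
  \sum_(j in resampling d e) weight d e j <=
  (if e \in S d then expR (- (q / 2)) else 1) *
    \sum_(j in resampling d e) 1.
Proof.
rewrite /weight /resampling; case: ifP => eS /=; last by rewrite mul1r.
rewrite (bigID (mem T)) /=.
rewrite (eq_bigr (fun=> expR (-1))); last by move=> j /andP[_ ->].
rewrite [X in _ + X](eq_bigr (fun=> 1)); last by move=> j /andP[_ /negPf->].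
rewrite !sumr_const.
have -> : #|[pred j in D | j \in T]| = #|T|.
  by apply: eq_card => j; rewrite !inE andbC;
    case: (boolP (j \in T)) => //= /(subsetP sTD).
have cD : (#|T| + #|[pred j | (j \in D) && (j \notin T)]| = #|D|)%N.
  rewrite -(cardsID T D); congr (_ + _)%N.
    by rewrite (setIidPr sTD).
  by apply: eq_card => j; rewrite !inE andbC.
have e1 : expR (-1) <= 2^-1 :> R.
  rewrite expRN lef_pV2 ?posrE ?expR_gt0//.
  by have := expR_ge1Dx (1 : R); rewrite -[1 + 1]/(2).
have e2 : 1 - q / 2 <= expR (- (q / 2)) by exact: expR_ge1Dx.
rewrite -[#|[pred j in D]|]/(#|D|).
apply: le_trans (ler_wpM2r (ltW D_gt0) e2).
have qD : q * #|D|%:R = #|T|%:R by rewrite divfK ?gt_eqF.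
move: (congr1 (fun n => n%:R : R) cD); rewrite natrD -mulr_natr => cDR.
have := ler0n R #|T|; nra.
Qed.

Let class_sum_le d :
  \sum_(c in family (resampling d)) expR (- #|hits c|%:R) <=
  \sum_(c in family (resampling d)) expR (- (q / 2 * #|S d|%:R)).
Proof.
rewrite (eq_bigr (fun c : {ffun E -> K} => \prod_e weight d e (c e))); last first.
  move=> c cd; rewrite -big_mkcond /= prodr_const -expRM_natl mulrN mulr1.
  rewrite /hits (S_family cd); congr (expR (- _%:R)).
  by apply: eq_card => e; rewrite !inE.
(* Distributivity turns the sum of products over the class into a product of sums, one per element;
   the right-hand side is brought to the same shape. *)
rewrite -bigA_distr_big_dep.
rewrite (eq_bigr (fun c : {ffun E -> K} =>
    expR (- (q / 2 * #|S d|%:R)) * \prod_(e : E) 1)); last first.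
  by move=> c _; rewrite big1_eq mulr1.
rewrite -mulr_sumr -(bigA_distr_big_dep _ (fun _ _ => 1)).
have -> : expR (- (q / 2 * #|S d|%:R)) =
    \prod_e (if e \in S d then expR (- (q / 2)) else 1).
  by rewrite -big_mkcond /= prodr_const -expRM_natl mulrN mulrC.
rewrite -big_split /=; apply: ler_prod => e _; rewrite sum_weight_le andbT.
by apply: sumr_ge0 => j _; rewrite /weight; case: ifP; rewrite ?expR_ge0.
Qed.

(* Chernoff bound by the exponential moment at -1, computed separately on each
   class of colourings that differ only by a recolouring of S in D. *)
Lemma resample_tail (m : R) :
  #|[pred c | (m <= #|S c|%:R) && (#|hits c|%:R <= q * m / 4)]|%:R <=
  expR (- (q * m / 4)) * #|{ffun E -> K}|%:R.
Proof.
have q_ge0 : 0 <= q by rewrite divr_ge0.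
have [i0 i0T] := set0Pn _ T_neq0.
have i0D := subsetP sTD _ i0T.
(* [r c] is the canonical representative of the class of [c]; the fibres of [r] are exactly the
   classes. *)
pose r c : {ffun E -> K} := [ffun e => if e \in S c then i0 else c e].
have S_r c : S (r c) = S c.
  by apply: S_resample => e eS; rewrite ffunE; [rewrite (negPf eS)|rewrite eS].
have r_r c : r (r c) = r c.
  by apply/ffunP => e; rewrite !ffunE S_r; case: ifP => // ->.
have r_fiber c d : r d = d -> (r c == d) = (c \in family (resampling d)).
  move=> rd; apply/eqP/familyP => [rcd e|cd].
    rewrite /resampling -rcd S_r; case: ifP => eS; first exact: S_D.
    by rewrite inE ffunE eS.
  have SE : S c = S d by apply: S_family; apply/familyP.
  apply/ffunP => e; rewrite ffunE SE; move: (cd e); rewrite /resampling.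
  case: ifP => eS; last by rewrite inE => /eqP.
  by rewrite -rd ffunE eS.
have moment : \sum_(c | m <= #|S c|%:R) expR (- #|hits c|%:R) <=
    \sum_(c | m <= #|S c|%:R) expR (- (q / 2 * m)).
  rewrite (partition_big r predT) //= [leRHS](partition_big r predT) //=.
  apply: ler_sum => d _; have [rd|rd] := eqVneq (r d) d; last first.
    by rewrite !big_pred0 // => c; apply/negP => /andP[_ /eqP rc];
      move: rd; rewrite -rc r_r eqxx.
  have [mS|mS] := boolP (m <= #|S d|%:R); last first.
    by rewrite !big_pred0 // => c; apply/negP => /andP[+ /eqP rc];
      rewrite -S_r rc; apply/negP.
  have fiberE c : (m <= #|S c|%:R) && (r c == d) = (c \in family (resampling d)).
    rewrite r_fiber //; case: (boolP (c \in _)) => cd; rewrite ?andbF //.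
    by rewrite (S_family cd) mS.
  rewrite !(eq_bigl _ _ fiberE); apply: le_trans (class_sum_le d) _.
  apply: ler_sum => c _; rewrite ler_expR lerN2 ler_wpM2l // divr_ge0 //.
(* Markov's inequality: each counted colouring contributes at least [expR (- (q * m / 4))] to the
   moment, which costs half of the exponent [q * m / 2]. *)
have -> : expR (- (q * m / 4)) = expR (q * m / 4) * expR (- (q / 2 * m)) :> R.
  by rewrite -expRD; congr expR; lra.
have total : \sum_(c | m <= #|S c|%:R) expR (- (q / 2 * m)) <=
    expR (- (q / 2 * m)) * #|{ffun E -> K}|%:R.
  rewrite sumr_const -[leLHS]mulr_natr ler_wpM2l ?expR_ge0 // ler_nat.
  exact: max_card.
rewrite -(mulrA (expR _)).
apply: le_trans (ler_wpM2l (expR_ge0 _) (le_trans moment total)).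
rewrite mulr_sumr -sumr_const [leRHS]big_mkcond [leLHS]big_mkcond /=.
apply: ler_sum => c _; rewrite inE; case: ifP => [/andP[-> hc]|_].
  by rewrite -expRD (le_trans _ (expR_ge1Dx _)) ?lerDl ?subr_ge0.
by case: ifP => // _; rewrite mulr_ge0 ?expR_ge0.
Qed.

End ResampleTail.

(* Locked, lest unification with set comprehensions unfold it. *)
HB.lock Definition maxmatching (V : finType) (F : {set {set V}}) :
  {set {set V}} :=
  [arg max_(M > set0 | (M \subset F) && trivIset M) #|M|]%N.

(** * Disjoint edge sets and maximum matchings *)

Section Matchings.

Variable V : finType.
Implicit Types (F M N : {set {set V}}) (U : {set V}).

(** Sending each point of [U] to its block of [M] reaches every block. *)
Lemma trivIset_card_touching M U :
  trivIset M -> (forall e, e \in M -> ~~ [disjoint e & U]) -> (#|M| <= #|U|)%N.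
Proof.
move=> tM MU; apply: leq_trans (leq_imset_card (pblock M) U).
apply/subset_leq_card/subsetP => e eM.
have /pred0Pn[x /andP[/= xe xU]] := MU e eM.
by apply/imsetP; exists x => //; rewrite (def_pblock tM eM xe).
Qed.

Lemma trivIsetU_cover M N :
  trivIset M -> trivIset N -> (forall e, e \in N -> [disjoint e & cover M]) ->
  trivIset (M :|: N).
Proof.
move=> /trivIsetP tM /trivIsetP tN NM.
have cross e f : e \in N -> f \in M -> [disjoint e & f].
  by move=> eN fM; apply: disjointWr (NM e eN); apply: bigcup_sup.
apply/trivIsetP => e f /setUP[eM|eN] /setUP[fM|fN]; [exact: tM| | |exact: tN].
  by rewrite disjoint_sym => _; exact: cross.
by move=> _; exact: cross.
Qed.

Lemma cardsU_cover M N :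
  set0 \notin N -> (forall e, e \in N -> [disjoint e & cover M]) ->
  #|M :|: N| = (#|M| + #|N|)%N.
Proof.
move=> N0 NM; rewrite cardsU (_ : M :&: N = set0) ?cards0 ?subn0 //.
apply/setP => e; rewrite !inE; apply/andP => -[eM eN].
have := disjointWr (bigcup_sup e eM : e \subset cover M) (NM e eN).
by rewrite -setI_eq0 setIid => /eqP e0; move: N0; rewrite -e0 eN.
Qed.

Lemma maxmatchingP F :
  [/\ maxmatching F \subset F, trivIset (maxmatching F) &
      forall M, M \subset F -> trivIset M -> (#|M| <= #|maxmatching F|)%N].
Proof.
rewrite maxmatching.unlock; case: arg_maxnP.
  by rewrite sub0set; apply/trivIsetP => e f; rewrite inE.
by move=> M /andP[MF tM] Mmax; split => // N NF tN; apply: Mmax; rewrite NF.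
Qed.

Lemma MM_maxmatching (G : sgraph V) : MM G = #|maxmatching (edges G)|.
Proof.
have [sM tM Mmax] := maxmatchingP (edges G).
apply/eqP; rewrite eqn_leq; apply/andP; split.
  by apply/bigmax_leqP => M /andP[]; exact: Mmax.
by apply: (@bigop.leq_bigmax_cond _ (is_matching G) (fun M => #|M|));
  rewrite /is_matching sM.
Qed.

Lemma edge_neq0 (G : sgraph V) : set0 \notin edges G.
Proof.
by apply/negP => /(forall_inP (edges_simple G)); rewrite cards0.
Qed.

Lemma card_cover_edges (G : sgraph V) M :
  M \subset edges G -> (#|cover M| <= 2 * #|M|)%N.
Proof.
move=> /subsetP MG; apply: leq_trans (leq_card_cover M) _.
rewrite -sum1_card big_distrr /=; apply: leq_sum => e eM.
by rewrite (eqP (forall_inP (edges_simple G) e (MG e eM))).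
Qed.

Lemma matching_card_vertices (G : sgraph V) M :
  is_matching G M -> (#|M| <= #|V|)%N.
Proof.
move=> /andP[/subsetP MG tM]; rewrite -cardsT.
apply: trivIset_card_touching => // e eM.
rewrite -setI_eq0 setIT; apply: contraNneq (edge_neq0 G) => <-; exact: MG.
Qed.

Lemma sgraph_inj (G H : sgraph V) : edges G = edges H -> G = H.
Proof.
case: G H => [F hF] [F' hF'] /= FF; subst F'.
by congr SGraph; exact: bool_irrelevance.
Qed.

End Matchings.

(** * Growth of the matching as the parts are revealed *)

Section Process.

Variable ALG : algorithm.
Hypothesis ALG_max : outputs_maximum_matching ALG.
Variables (V : finType) (G : sgraph V) (k : nat).

Implicit Types (c : partitioning G k) (i j : 'I_k).

Let E : finType := {e : {set V} | e \in edges G}.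

Definition prefix_edges c (i : nat) : {set {set V}} :=
  \bigcup_(j < k | (j < i)%N) edges (ALG (part_graph c j)).

Definition old_vertices c (i : nat) : {set V} :=
  cover (maxmatching (prefix_edges c i)).

Definition old_edges c i : {set {set V}} :=
  [set e in part_edges c i | ~~ [disjoint e & old_vertices c i]].

(** The index is only required to be at least [i], not equal to [i]: this keeps the set unchanged
    when its edges are redistributed among the parts from [i] on. *)
Definition fresh_edges c i : {set E} :=
  [set e | [&& val e \in maxmatching (edges G), (i <= c e)%N,
     [disjoint val e & old_vertices c i] &
     [disjoint val e & cover (maxmatching (old_edges c i))]]].

Let union c : sgraph V := union_graph (fun i => ALG (part_graph c i)).

Lemma part_edgesP c i e :
  reflect (exists2 x : E, c x = i & e = val x) (e \in part_edges c i).
Proof.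
apply: (iffP imsetP) => -[x]; first by rewrite inE => /eqP cx ->; exists x.
by move=> cx ->; exists x; rewrite // inE cx.
Qed.

Lemma part_edges_sub c i : part_edges c i \subset edges G.
Proof. by apply/subsetP => _ /part_edgesP[x _ ->]; exact: valP. Qed.

Lemma eq_part_edges c c' i :
  (forall x : E, (c x == i) || (c' x == i) -> c x = c' x) ->
  part_edges c i = part_edges c' i.
Proof.
move=> cc'; apply/setP => e; apply/part_edgesP/part_edgesP => -[x cx ->];
  exists x => //.
  by rewrite -cc' // cx eqxx.
by rewrite cc' // cx eqxx orbT.
Qed.

(** Earlier parts contain no fresh edge, before or after the change, so A is unchanged. Edges of
    part [i] that touch V(A) are not fresh, so O is unchanged too. *)
Lemma fresh_resample c c' i :
  (forall x, x \notin fresh_edges c i -> c' x = c x) ->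
  (forall x, x \in fresh_edges c i -> (i <= c' x)%N) ->
  fresh_edges c' i = fresh_edges c i.
Proof.
move=> out inn.
have fresh_ge x : x \in fresh_edges c i -> (i <= c x)%N by rewrite inE => /and4P[].
have prefixE : prefix_edges c' i = prefix_edges c i.
  apply: eq_bigr => j ji; congr (edges (ALG _)); apply: sgraph_inj.
  apply: eq_part_edges => x cx; apply: out; apply/negP => xf.
  have := fresh_ge x xf; have := inn x xf.
  by case/orP: cx => /eqP ->; rewrite (leqNgt i j) ji.
have oldE : old_vertices c' i = old_vertices c i by rewrite /old_vertices prefixE.
have old_edgesE : old_edges c' i = old_edges c i.
  apply/setP => e; rewrite !inE oldE; apply: andb_id2r => eold.
  have outE (x : E) : e = val x -> c' x = c x.
    by move=> ex; apply: out; rewrite inE -ex (negPf eold) !andbF.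
  by apply/part_edgesP/part_edgesP => -[x cx ex]; exists x => //;
    rewrite -cx outE.
apply/setP => x; have [xf|xf] := boolP (x \in fresh_edges c i).
  move: (xf); rewrite !inE oldE old_edgesE => /and4P[-> _ -> ->].
  by rewrite inn.
by rewrite -(negbTE xf) !inE oldE old_edgesE (out _ xf).
Qed.

Lemma prefix_edges_sub c (i : nat) : prefix_edges c i \subset edges G.
Proof.
apply/bigcupsP => j _; apply: subset_trans (part_edges_sub c j).
by have [/andP[]] := ALG_max (part_graph c j).
Qed.

Lemma prefix_growth c i :
  (#|maxmatching (prefix_edges c i)| + #|[set x in fresh_edges c i | c x == i]|
    <= #|maxmatching (prefix_edges c i.+1)|)%N.
Proof.
set X := [set x in _ | _].
have [sA tA _] := maxmatchingP (prefix_edges c i).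
have [sO tO Omax] := maxmatchingP (old_edges c i).
have [sB tB Bmax] := maxmatchingP (prefix_edges c i.+1).
have [/andP[sN tN] Nmax] := ALG_max (part_graph c i).
set A := maxmatching _ in sA tA *; set O := maxmatching _ in sO tO Omax.
set N := edges (ALG _) in sN tN Nmax.
have [sM tM _] := maxmatchingP (edges G).
pose Nnew := [set e in N | [disjoint e & old_vertices c i]].
pose vX : {set {set V}} := val @: X.
have sNG : N \subset edges G by apply: subset_trans sN (part_edges_sub c i).
have vX_tr : trivIset vX.
  apply: trivIsetS tM; apply/subsetP => _ /imsetP[x + ->].
  by rewrite !inE => /andP[/and4P[]].
have vXO e : e \in vX -> [disjoint e & cover O].
  by move=> /imsetP[x + ->]; rewrite !inE => /andP[/and4P[]].
have vX0 : set0 \notin vX.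
  by apply/imsetP => -[x _ x0]; move: (edge_neq0 G); rewrite x0 (valP x).
have OXN : (#|O| + #|X| <= #|N|)%N.
  have -> : #|X| = #|vX| by rewrite card_imset //; exact: val_inj.
  rewrite -cardsU_cover // Nmax //.
  rewrite /is_matching trivIsetU_cover // andbT subUset; apply/andP; split.
    by apply: subset_trans sO _; apply/subsetP => e; rewrite inE => /andP[].
  apply/subsetP => _ /imsetP[x + ->]; rewrite inE => /andP[_ /eqP cx].
  by apply/part_edgesP; exists x.
(* The edges of [N] outside [Nnew] touch V(A), hence form a matching among the old edges, where [O]
   is maximum. *)
have NO : (#|N :\: Nnew| <= #|O|)%N.
  apply: Omax; last exact: trivIsetS (subsetDl _ _) tN.
  apply/subsetP => e; rewrite !inE => /andP[+ eN]; rewrite eN /= => ->.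
  by rewrite andbT (subsetP sN).
have Nnew_sub : Nnew \subset N by apply/subsetP => e; rewrite inE => /andP[].
have NnewA e : e \in Nnew -> [disjoint e & cover A] by rewrite inE => /andP[].
have XNnew : (#|X| <= #|Nnew|)%N.
  rewrite -(leq_add2l #|O|); apply: leq_trans OXN _.
  by rewrite -(cardsID Nnew N) (setIidPr Nnew_sub) addnC leq_add2r.
apply: leq_trans (_ : #|A :|: Nnew| <= _)%N.
  rewrite cardsU_cover ?leq_add2l //; apply: contra (edge_neq0 G) => e0.
  exact: subsetP sNG _ (subsetP Nnew_sub _ e0).
apply: Bmax; last by apply: trivIsetU_cover => //; exact: trivIsetS tN.
rewrite subUset; apply/andP; split.
  apply: subset_trans sA _; apply/bigcupsP => j ji.
  by apply: (bigcup_sup j); exact: ltnW.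
apply: subset_trans Nnew_sub _; rewrite /N /prefix_edges.
exact: (bigcup_sup i).
Qed.

(* 6|A| bounds |V(A)| + |V(O)|, since |V(O)| = 2|O| <= 2|V(A)| = 4|A|. *)
Lemma fresh_card c i :
  (#|[set x : E | (val x \in maxmatching (edges G)) && (i <= c x)%N]| <=
   #|fresh_edges c i| + 6 * #|maxmatching (prefix_edges c i)|)%N.
Proof.
set L := [set x : E | _].
have [sA tA _] := maxmatchingP (prefix_edges c i).
have [sO tO _] := maxmatchingP (old_edges c i).
have [sM tM _] := maxmatchingP (edges G).
have cA := card_cover_edges (subset_trans sA (prefix_edges_sub c i)).
have sOG : maxmatching (old_edges c i) \subset edges G.
  apply: subset_trans (subset_trans sO _) (part_edges_sub c i).
  by apply/subsetP => e; rewrite inE => /andP[].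
have cO := card_cover_edges sOG.
have OA : (#|maxmatching (old_edges c i)| <= #|old_vertices c i|)%N.
  apply: trivIset_card_touching => // e /(subsetP sO).
  by rewrite inE => /andP[].
set U := old_vertices c i :|: cover (maxmatching (old_edges c i)).
have cU : (#|U| <= 6 * #|maxmatching (prefix_edges c i)|)%N.
  rewrite (leq_trans (leq_card_setU _ _)) // -[6%N]/(2 + 2 * 2)%N mulnDl.
  by rewrite leq_add // (leq_trans cO) // -mulnA leq_mul2l (leq_trans OA).
have LU : (#|L :\: fresh_edges c i| <= #|U|)%N.
  have <- : #|[set val x | x in L :\: fresh_edges c i]| = #|L :\: fresh_edges c i|.
    by rewrite card_imset //; exact: val_inj.
  apply: trivIset_card_touching.
    apply: trivIsetS tM; apply/subsetP => _ /imsetP[x + ->].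
    by rewrite !inE => /andP[_ /andP[]].
  move=> _ /imsetP[x + ->]; rewrite !inE => /andP[+ /andP[xM ix]].
  rewrite xM ix /=; apply: contra => xU; apply/andP; split.
    by apply: disjointWr xU; exact: subsetUl.
  by apply: disjointWr xU; exact: subsetUr.
have LF : (#|L :&: fresh_edges c i| <= #|fresh_edges c i|)%N.
  by apply/subset_leq_card/subsetIr.
by rewrite -(cardsID (fresh_edges c i) L) leq_add // (leq_trans LU).
Qed.

Lemma prefix_MM c (i : nat) : (#|maxmatching (prefix_edges c i)| <= MM (union c))%N.
Proof.
have [sA tA _] := maxmatchingP (prefix_edges c i).
rewrite MM_maxmatching; have [_ _] := maxmatchingP (edges (union c)); apply=> //.
apply: subset_trans sA _; apply/bigcupsP => j _.
exact: (bigcup_sup j).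
Qed.

End Process.

(** * Union bound over the unlucky events for a fixed graph *)

Section FailureProbability.

Variables (R : realType) (ALG : algorithm).
Hypothesis ALG_max : outputs_maximum_matching ALG.
Variables (V : finType) (G : sgraph V) (k : nat).
Hypothesis k_gt0 : (0 < k)%N.

Let E : finType := {e : {set V} | e \in edges G}.

Lemma prob_partitioningE (A : pred (partitioning G k)) :
  prob_partitioning R A = #|A|%:R / #|partitioning G k|%:R.
Proof.
rewrite /prob_partitioning prodr_const sumr_const card_ffun card_ord natrX.
by rewrite -[LHS]mulr_natl exprVn.
Qed.

Lemma card_upper_half : (k <= 2 * #|[set j : 'I_k | (k./2 <= j)%N]|)%N.
Proof.
rewrite -sum1_card (eq_bigl (fun j : 'I_k => (k./2 <= j)%N)); last first.
  by move=> j; rewrite inE.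
rewrite -(big_geq_mkord _ k predT (fun=> 1%N)) sum_nat_const_nat muln1.
lia.
Qed.

Let mu : R := (MM G)%:R.
Let matched : {set E} := [set x | val x \in maxmatching (edges G)].
Let upper : {set 'I_k} := [set j : 'I_k | (k./2 <= j)%N].

(* If neither event below happens and MM(union) < mu/128, then at each step i <= k/2
   more than mu/8 edges of M* are unrevealed and more than
   mu/8 - 6 mu/128 >= mu/16 are fresh, so A gains at least mu/(64k). *)
Let unlucky_half (c : partitioning G k) : bool :=
  (mu <= #|matched|%:R) &&
  (#|[set x in matched | c x \in upper]|%:R <=
     #|upper|%:R / #|[set: 'I_k]|%:R * mu / 4).

Let unlucky_step (i : 'I_k) (c : partitioning G k) : bool :=
  (mu / 16 <= #|fresh_edges ALG c i|%:R) &&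
  (#|[set x in fresh_edges ALG c i | c x \in [set i]]|%:R <=
     #|[set i]|%:R / #|[set j : 'I_k | (i <= j)%N]|%:R * (mu / 16) / 4).

(** The exponent is [q * m / 4] with [m = mu / 16] and [q] replaced by its lower bound [1 / k]; it
    is also the gain guaranteed at each step. *)
Let rate : R := expR (- (mu / (64 * k%:R))).

Let kR_gt0 : 0 < k%:R :> R. Proof. by rewrite ltr0n. Qed.
Let mu_ge0 : 0 <= mu. Proof. exact: ler0n. Qed.

Let card_matched : #|matched| = MM G.
Proof.
rewrite MM_maxmatching -(card_imset _ val_inj); apply: eq_card => e.
have [/subsetP sM _ _] := maxmatchingP (edges G).
apply/imsetP/idP => [[x + ->]|eM]; first by rewrite inE.
by exists (exist _ e (sM e eM)); rewrite ?inE.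
Qed.

Let upper_half : 2^-1 <= #|upper|%:R / #|[set: 'I_k]|%:R :> R.
Proof.
rewrite cardsT card_ord ler_pdivlMr // ler_pdivrMl //.
by rewrite -natrM ler_nat card_upper_half.
Qed.

Let upper_neq0 : upper != set0.
Proof.
rewrite -card_gt0 -(ltn_pmul2l (isT : (0 < 2)%N)) muln0.
exact: leq_trans k_gt0 card_upper_half.
Qed.

Let ge_neq0 (i : 'I_k) : [set i] \subset [set j : 'I_k | (i <= j)%N].
Proof. by rewrite sub1set inE. Qed.

Let step_rate (i : 'I_k) :
  mu / (64 * k%:R) <=
  #|[set i]|%:R / #|[set j : 'I_k | (i <= j)%N]|%:R * (mu / 16) / 4.
Proof.
set d := #|[set j : 'I_k | (i <= j)%N]|.
have d_gt0 : 0 < d%:R :> R.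
  by rewrite ltr0n card_gt0; apply/set0Pn; exists i; rewrite inE.
have dk : d%:R <= k%:R :> R by rewrite ler_nat -[leqRHS]card_ord max_card.
have : k%:R^-1 <= d%:R^-1 :> R by rewrite lef_pV2.
by move=> /(ler_wpM2l mu_ge0); rewrite cards1 invfM mul1r; lra.
Qed.

(** The tail bound is applied to the constant set [matched], with all classes as [D]. Here
    [q >= 1/2], so the exponent is at least [mu / 8]. *)
Let card_unlucky_half :
  #|unlucky_half|%:R <= rate * #|partitioning G k|%:R.
Proof.
apply: le_trans (_ : expR (- (#|upper|%:R / #|[set: 'I_k]|%:R * mu / 4)) *
    #|partitioning G k|%:R <= _); last first.
  rewrite ler_wpM2r // ler_expR lerN2.
  have /(ler_wpM2l mu_ge0) : k%:R^-1 <= 1 :> R by rewrite invf_le1 // ler1n.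
  by have := ler_wpM2r mu_ge0 upper_half; have := mu_ge0; rewrite invfM; lra.
by apply: (resample_tail (S := fun=> matched)) => //; exact: subsetT.
Qed.

Let card_unlucky_step i :
  #|unlucky_step i|%:R <= rate * #|partitioning G k|%:R.
Proof.
apply: le_trans (_ : expR (- (#|[set i]|%:R /
    #|[set j : 'I_k | (i <= j)%N]|%:R * (mu / 16) / 4)) *
    #|partitioning G k|%:R <= _); last first.
  by rewrite ler_wpM2r // ler_expR lerN2.
apply: (resample_tail (S := fun c => fresh_edges ALG c i)) => //.
- by apply/set0Pn; exists i; rewrite inE.
- by move=> c x; rewrite !inE => /and4P[].
- move=> c c' out inn; apply: fresh_resample => // x xf.
  by have := inn x xf; rewrite inE.
Qed.

Let lucky_large (c : partitioning G k) :
  ~~ unlucky_half c ->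
  (forall i : 'I_k, (i <= k./2)%N -> ~~ unlucky_step i c) ->
  mu / 128 <= (MM (union_graph (fun i => ALG (part_graph c i))))%:R.
Proof.
move=> half step; rewrite leNgt; apply/negP => small.
pose a i : R := #|maxmatching (prefix_edges ALG c i)|%:R.
have a_small i : a i < mu / 128.
  by apply: le_lt_trans small; rewrite ler_nat; exact: prefix_MM.
pose late i := [set x : E | (val x \in maxmatching (edges G)) && (i <= c x)%N].
have late_half : mu / 8 < #|late k./2|%:R.
  move: half; rewrite /unlucky_half card_matched lexx /= -ltNge.
  have -> : [set x in matched | c x \in upper] = late k./2.
    by apply/setP => x; rewrite !inE.
  by apply: le_lt_trans; have := ler_wpM2r mu_ge0 upper_half; lra.
have growth (i : 'I_k) : (i <= k./2)%N -> a i + mu / (64 * k%:R) <= a i.+1.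
  move=> ih.
  have fresh : mu / 16 <= #|fresh_edges ALG c i|%:R.
    have : #|late k./2|%:R <= #|late i|%:R :> R.
      rewrite ler_nat; apply/subset_leq_card/subsetP => x; rewrite !inE.
      by move=> /andP[-> /=]; exact: leq_trans.
    have := fresh_card ALG_max c i; rewrite -/(late i) -(ler_nat R) natrD natrM.
    by move: (a_small i) late_half mu_ge0; rewrite -/(a i); lra.
  move: (step i ih); rewrite /unlucky_step fresh /= -ltNge => hit.
  have := prefix_growth ALG_max c i; rewrite -(ler_nat R) natrD; apply: le_trans.
  rewrite lerD2l (le_trans (step_rate i)) // (le_trans (ltW hit)) // ler_nat.
  by apply/subset_leq_card/subsetP => x; rewrite !inE.
have h_lt : (k./2 < k)%N by rewrite -divn2 ltn_Pdiv.
have a_ge i : (i <= k./2.+1)%N -> i%:R * (mu / (64 * k%:R)) <= a i.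
  elim: i => [|i IH] ih; first by rewrite mul0r.
  have := growth (Ordinal (leq_trans ih h_lt)) ih; apply: le_trans => /=.
  by rewrite -natr1 mulrDl mul1r lerD2r IH // ltnW.
have := a_ge _ (leqnn _); rewrite leNgt => /negP; apply.
apply: lt_le_trans (a_small _) _.
(* Steps [0] to [k./2] are [k./2 + 1] in number, at least [k / 2] despite the rounding; the total
   gain is thus at least [mu / 128], a contradiction. *)
have : k%:R <= 2 * k./2.+1%:R :> R.
  by rewrite -natrM ler_nat mul2n -{1}(odd_double_half k) doubleS -addn2 addnC
    leq_add2l; case: odd.
by move=> /(ler_wpM2l mu_ge0); rewrite mulrA ler_pdivlMr ?mulr_gt0 //; lra.
Qed.

Lemma prob_large_matching :
  1 - k.+1%:R * rate <=
  prob_partitioning R (fun c : partitioning G k => mu / 128 <=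
    (MM (union_graph (fun i => ALG (part_graph c i))))%:R).
Proof.
set A : pred (partitioning G k) := fun c => _.
have N_gt0 : 0 < #|partitioning G k|%:R :> R.
  by rewrite card_ffun card_ord ltr0n expn_gt0 k_gt0.
rewrite prob_partitioningE ler_pdivlMr // mulrBl mul1r lerBlDr.
rewrite -{1}(cardC A) natrD lerD2l.
(* Union bound by double counting; its [k + 1] events give the factor [k.+1]. *)
have fail_sub : (#|[predC A]| <= #|unlucky_half| + \sum_(i < k) #|unlucky_step i|)%N.
  rewrite -!sum1_card; under [X in (_ <= _ + X)%N]eq_bigr do rewrite -sum1_card.
  rewrite (exchange_big_dep predT) //= [leqLHS]big_mkcond /=.
  rewrite [X in (_ <= X + _)%N]big_mkcond /= -big_split; apply: leq_sum => c _ /=.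
  case: ifP => // cA; rewrite -[c \in unlucky_half]/(unlucky_half c).
  case: ifP => //= /negbT half; rewrite add0n lt0n; apply/negP => /eqP.
  rewrite sum1_card => /card0_eq none.
  have := lucky_large half; move: cA; rewrite inE => /negP cA big; apply: cA.
  by apply: big => i _; apply/negbT; exact: none i.
apply: le_trans (_ : (#|unlucky_half| + \sum_(i < k) #|unlucky_step i|)%:R <= _).
  by rewrite ler_nat.
rewrite natrD natr_sum -natr1 mulrDl mul1r mulrDl addrC lerD ?card_unlucky_half //.
apply: le_trans (ler_sum _ (fun i _ => card_unlucky_step i)) _.
by rewrite sumr_const card_ord -[leLHS]mulr_natl mulrA.
Qed.

End FailureProbability.

(** * From the fixed-graph bound to high probability *)

Lemma ln_nat_ge1 (R : realType) (n : nat) : (4 <= n)%N -> 1 <= ln n%:R :> R.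
Proof.
move=> n4.
have half : expR 2^-1 <= 2 :> R.
  have := expR_ge1Dx (- 2^-1 : R); rewrite expRN => e.
  rewrite -[leRHS]invrK -[leLHS]invrK lef_pV2 ?posrE ?invr_gt0 ?expR_gt0 //.
  by lra.
have e4 : expR 1 <= 4 :> R.
  have -> : expR 1 = expR 2^-1 ^+ 2 :> R by rewrite -expRM_natl divff ?pnatr_eq0.
  rewrite (_ : 4 = 2 ^+ 2); last by rewrite -natrX.
  by rewrite lerXn2r // nnegrE ?expR_ge0.
rewrite -ler_expR lnK ?posrE ?ltr0n ?(leq_trans _ n4) //.
by rewrite (le_trans e4) // ler_nat.
Qed.

(** The hypothesis on [m] makes the exponential at most [n ^- (a + 2)]; the two spare powers of [n]
    absorb [k + 1], since [k <= m <= n]. *)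
Lemma failure_le_inv_poly (R : realType) (n k m a : nat) :
  (4 <= n)%N -> (0 < k)%N -> (m <= n)%N ->
  k%:R * ln n%:R <= (64 * a.+2%:R)^-1 * m%:R :> R ->
  k.+1%:R * expR (- (m%:R / (64 * k%:R))) <= n%:R ^- a :> R.
Proof.
move=> n4 k_gt0 mn km.
have ln1 := ln_nat_ge1 R n4.
have n_gt0 : 0 < n%:R :> R by rewrite ltr0n (leq_trans _ n4).
have a2_ge1 : 1 <= a.+2%:R :> R by rewrite ler1n.
have k_pos : 0 < k%:R :> R by rewrite ltr0n.
have a_pos : 0 < 64 * a.+2%:R :> R by rewrite mulr_gt0.
rewrite [leRHS]mulrC ler_pdivlMr // in km.
have kn : (k <= n)%N.
  rewrite -(ler_nat R); have : m%:R <= n%:R :> R by rewrite ler_nat.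
  have : 0 <= k%:R * (ln n%:R - 1) :> R by rewrite mulr_ge0 ?subr_ge0 // ltW.
  set l := ln _ in km *; set A := a.+2%:R in km a2_ge1 *; nra.
have rate : expR (- (m%:R / (64 * k%:R))) <= n%:R ^- a.+2 :> R.
  have -> : n%:R ^- a.+2 = expR (- (a.+2%:R * ln n%:R)) :> R.
    by rewrite expRN expRM_natl lnK ?posrE.
  rewrite ler_expR lerN2 ler_pdivlMr ?mulr_gt0 //; lra.
apply: le_trans (ler_wpM2l (ler0n _ _) rate) _.
rewrite ler_pdivrMr ?exprn_gt0 // -addn2 exprD mulKf ?expf_neq0 ?gt_eqF //.
rewrite -natrX ler_nat; nia.
Qed.

From mathcomp Require Import boolp classical_sets functions topology.
From mathcomp Require Import normedtype landau.

Import numFieldNormedType.Exports.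

Local Open Scope classical_set_scope.

Theorem theorem1 (R : realType) :
  exists (C : R) (s : nat -> nat),
    0 < C /\
    (fun n : nat => (s n)%:R : R) =O_\oo (fun n : nat => n%:R : R) /\
    forall ALG : algorithm, outputs_maximum_matching ALG ->
    forall I : nat -> instance,
      (forall j, (1 <= parts (I j))%N) ->
      nvert (I j) @[j --> \oo] --> \oo ->
      (fun j => (parts (I j))%:R * ln (nvert (I j))%:R : R)
        =o_\oo (fun j => (MM (graph (I j)))%:R : R) ->
      randomized_composable_coreset MM ALG C s I.
Proof.
(* [128] is the denominator in [prob_large_matching]; [id] suffices as size bound because a matching
   has at most one edge per vertex. *)
exists 128, id; split=> //; split.
  by apply/eqO_exP; exists 1 => //; near=> n; rewrite mul1r.
move=> ALG ALG_max I parts_gt0 nvert_oo /eqoP MM_large; split.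
  move=> V H; have [matching _] := ALG_max V H.
  by split; [have /andP[] := matching|exact: matching_card_vertices matching].
(* This is the epsilon at which the little-o hypothesis is used, chosen to match
   [failure_le_inv_poly]. *)
move=> a; have a_gt0 : 0 < (64 * a.+2%:R)^-1 :> R by rewrite invr_gt0 mulr_gt0.
near=> j.
apply: le_trans (prob_large_matching R ALG_max (graph (I j)) (parts_gt0 j)).
rewrite lerD2l lerN2; apply: failure_le_inv_poly => //.
- near: j; exact: (nvert_oo _ (nbhs_infty_ge 4)).
- rewrite MM_maxmatching; have [sM tM _] := maxmatchingP (edges (graph (I j))).
  by apply: (@matching_card_vertices _ (graph (I j))); apply/andP.
- rewrite -[X in _ <= _ * X]ger0_norm //; apply: le_trans (ler_norm _) _.
  by near: j; exact: MM_large.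
Unshelve. all: by end_near. Qed.
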